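(* Let $\alpha\in[0,1]$ and $\rho>0$ be fixed, and let $A\in(0,\infty)$. For every $f\in C[0,\infty)\cap D[0,\infty)$, the sequence $A_n^{\alpha,\rho}(f;\cdot)$ converges to $f$ as $n\to\infty$, uniformly on each compact subset of $[0,A]$.
   Context: For $n\in\mathbb{N}$, $n\ge 1$, $k=0,1,2,\dots$, $\alpha\in[0,1]$, $\rho>0$ and $x\in[0,\infty)$ put $$p_{n,k}^{\alpha}(x)=\frac{x^{k-1}}{(1+x)^{n+k-1}}\left\{\frac{\alpha x}{1+x}\binom{n+k-1}{k}-(1-\alpha)(1+x)\binom{n+k-3}{k-2}+(1-\alpha)x\binom{n+k-1}{k}\right\},$$ where $\binom{n+k-3}{k-2}$ is taken to be $0$ for $k=0,1$ (so for $k=0$ the factor $x^{-1}$ cancels and $p_{n,0}^{\alpha}(x)=(1+x)^{-(n-1)}\left(\frac{\alpha}{1+x}+1-\alpha\right)$, also at $x=0$). For $t\ge 0$ put $$\mu_{n,k}^{\rho}(t)=\frac{t^{k\rho}}{B(k\rho+1,n\rho)(1+t)^{n\rho+k\rho+1}},$$ where $B$ is the Beta function. The operators are $$A_n^{\alpha,\rho}(f;x)=\sum_{k=0}^{\infty}p_{n,k}^{\alpha}(x)\int_0^{\infty}\mu_{n,k}^{\rho}(t)f(t)\,dt .$$ $C_B[0,\infty)$ denotes the continuous bounded real functions on $[0,\infty)$, and $D[0,\infty)=\{f\in C_B[0,\infty):\ \lim_{x\to\infty}\frac{f(x)}{1+x^2}\text{ exists and is finite}\}$. *)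

(* Defs.v *)
From mathcomp Require Import all_boot all_order all_algebra.
From mathcomp Require Import all_classical all_reals all_analysis.
Export numFieldNormedType.Exports.

Set Implicit Arguments.
Unset Strict Implicit.
Unset Printing Implicit Defensive.

Import Order.TTheory GRing.Theory Num.Theory.

Local Open Scope classical_set_scope.
Local Open Scope ring_scope.

(* Functions on [0, +oo[ are represented by total functions R -> R of which
   only the values on [0, +oo[ are used. *)
Section alpha_baskakov_durrmeyer.
Context {R : realType}.
Implicit Types (alpha rho x t : R) (n k : nat) (f : R -> R).

Definition halfline : set R := [set` `[0, +oo[].

(* Real-parameter version of the library's beta_fun, which only takes
   natural arguments. *)
Definition Beta (a b : R) : R :=
  \int[lebesgue_measure]_(t in [set` `]0, 1[])
    (t `^ (a - 1) * (1 - t) `^ (b - 1)).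

(* 'C(n + k - 3, k - 2), read as 0 for k = 0, 1. *)
Definition binom_shift n k : nat :=
  if k is j.+2 then 'C(n + k - 3, j) else 0%N.

(* Meant for 1 <= n. The case k = 0 is the general formula with the factor
   x^-1 cancelled, so that it also holds at x = 0. *)
Definition p_basis alpha n k x : R :=
  if k is j.+1 then
    x ^+ j / (1 + x) ^+ (n + k - 1) *
    (alpha * x / (1 + x) * 'C(n + k - 1, k)%:R
     - (1 - alpha) * (1 + x) * (binom_shift n k)%:R
     + (1 - alpha) * x * 'C(n + k - 1, k)%:R)
  else (1 + x) ^- (n - 1) * (alpha / (1 + x) + (1 - alpha)).

Definition mu_kernel rho n k t : R :=
  t `^ (k%:R * rho) /
  (Beta (k%:R * rho + 1) (n%:R * rho)
   * (1 + t) `^ (n%:R * rho + k%:R * rho + 1)).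

Definition A_op alpha rho n f x : R :=
  limn (series (fun k => p_basis alpha n k x *
    \int[lebesgue_measure]_(t in halfline) (mu_kernel rho n k t * f t))).

Definition C_space : set (R -> R) :=
  [set f | {within halfline, continuous f}].

Definition C_B : set (R -> R) :=
  C_space `&` [set f | [bounded f x | x in halfline]].

Definition D_space : set (R -> R) :=
  C_B `&` [set f | cvg (f x / (1 + x ^+ 2) @[x --> +oo%R])].

End alpha_baskakov_durrmeyer.

(* Main.v *)
Require Import Defs.
From mathcomp Require Import all_boot all_order all_algebra.
From mathcomp Require Import all_classical all_reals all_analysis.
From mathcomp Require Import measurable_realfun ring lra.
Import Order.TTheory GRing.Theory Num.Theory.
Import numFieldNormedType.Exports.
Local Open Scope classical_set_scope.
Local Open Scope ring_scope.

(** With [V_{n,k}(x) = C(n+k-1,k) x^k / (1+x)^(n+k)] the Baskakov basis, the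
    alpha-basis is [p_{n,k} = c1 V_{n,k} - c2 V_{n,k-2}] where
    [c1 = alpha + (1-alpha)(1+x)] and [c2 = (1-alpha) x], so [c1 - c2 = 1].
    Although [p_{n,k}] takes negative values, the operator is therefore
    [c1 L0 - c2 L2] with two positive operators [L0] and [L2], the second using
    the kernels shifted by two indices, and [c1 + c2 <= 1 + 2x] is bounded on
    [[0, A]]. It remains to show that [L0] and [L2] approximate [f].

    Under [u = t/(1+t)] the kernel [mu_{n,k}] becomes the Beta density with
    parameters [k rho + 1] and [n rho], whose mean is close to [k/(n+k)] and whose
    variance is at most [1/(n rho)].  As [f] is bounded and continuous,
    [|f t - f x| <= e + C (t/(1+t) - x/(1+x))^2] for [x <= A], which bounds the error
    at index [k] by [e + 2C (k-nx)^2/n^2 + O(1/n)]; finally the sum over [k] of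
    [V_{n,k}(x) (k-nx)^2] is [n x (1+x)]. *)

(** * Limits of real series *)

Section series_limits.
Context {R : realType}.
Implicit Types (u v c : R^nat) (l m : R).

Lemma cvg_series_recl u l :
  series (fun k => u k.+1) @ \oo --> l -> series u @ \oo --> u 0%N + l.
Proof.
move=> ul; rewrite -cvg_shiftS.
rewrite (_ : [sequence _]_n = fun n => u 0%N + series (fun k => u k.+1) n).
  by apply: cvgD => //; exact: cvg_cst.
by apply/funext => n; rewrite /series/= big_nat_recl.
Qed.

Lemma eq_cvg_series u v l :
  u =1 v -> series v @ \oo --> l -> series u @ \oo --> l.
Proof. by move=> /funext ->. Qed.

Lemma cvg_series_linear (a b : R) u v l m :
  series u @ \oo --> l -> series v @ \oo --> m ->
  series (fun k => a * u k + b * v k) @ \oo --> a * l + b * m.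
Proof.
move=> ul vm.
rewrite (_ : series _ = fun n => a * series u n + b * series v n).
  by apply: cvgD; apply: cvgMl_tmp.
by apply/funext => n; rewrite /series/= big_split !mulr_sumr.
Qed.

(** Absolute convergence by comparison. With [u] the Baskakov weights, it turns an error bound at
    each index into a bound on a whole positive operator, convergence included. *)
Lemma series_weighted_le u c v l :
  (forall k, 0 <= u k) -> (forall k, `|c k| <= v k) ->
  series (fun k => u k * v k) @ \oo --> l ->
  exists2 m, series (fun k => u k * c k) @ \oo --> m & `|m| <= l.
Proof.
move=> u0 cv uvl.
have uc k : `|u k * c k| <= u k * v k.
  by rewrite normrM ger0_norm// ler_wpM2l.
have cn : cvgn [normed series (fun k => u k * c k)].
  apply: (@series_le_cvg _ _ (fun k => u k * v k)) => //=.
    by move=> k; apply: le_trans (uc k).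
  by apply/cvg_ex; exists l.
exists (limn (series (fun k => u k * c k))); first exact: normed_cvg.
apply: (le_trans (lim_series_norm cn)).
rewrite -(cvg_lim _ uvl)//; apply: lim_series_le => //.
by apply/cvg_ex; exists l.
Qed.

End series_limits.

(** * Baskakov basis: total mass, moments, link with the alpha-basis *)

Section baskakov.
Context {R : realType}.
Implicit Types (x : R) (n k : nat).

Definition bask n k x : R := 'C(n + k - 1, k)%:R * x ^+ k / (1 + x) ^+ (n + k).

Lemma bask_ge0 n k x : 0 <= x -> 0 <= bask n k x.
Proof. by move=> x0; rewrite !mulr_ge0// ?invr_ge0 exprn_ge0// addr_ge0. Qed.

Lemma baskS0 n x : 0 <= x -> bask n.+1 0 x = bask n 0 x / (1 + x).
Proof.
move=> x0; rewrite /bask !bin0 !addn0 exprS expr0.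
by field; apply/andP; split; rewrite ?expf_eq0; lra.
Qed.

(** Pascal's rule for ['C(n + k + 1, k + 1)]. *)
Lemma baskSS n k x : 0 <= x ->
  bask n.+1 k.+1 x = bask n k.+1 x / (1 + x) + x / (1 + x) * bask n.+1 k x.
Proof.
move=> x0; have x1 : 1 + x != 0 by lra.
rewrite /bask !addSn !addnS !subn1/= binS natrD !exprS.
by field; rewrite expf_neq0.
Qed.

Lemma series_baskS n N x : 0 <= x ->
  series (fun k => bask n.+1 k x) N.+1 =
  series (fun k => bask n k x) N.+1 / (1 + x)
  + x / (1 + x) * series (fun k => bask n.+1 k x) N.
Proof.
move=> x0; rewrite /series/= big_nat_recl//= [in RHS]big_nat_recl//= baskS0//.
under eq_bigr do rewrite baskSS//.
by rewrite big_split/= -mulr_suml -mulr_sumr addrA -mulrDl.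
Qed.

(** Induction on [n] in place of the negative binomial series: partial sums are monotone and
    bounded, and the recurrence passes to the limit as [l = 1/(1+x) + x/(1+x) l], which forces
    [l = 1]. *)
Lemma cvg_series_bask n x : 0 <= x ->
  series (fun k => bask n k x) @ \oo --> (1 : R).
Proof.
move=> x0; have x1 : 0 < 1 + x by lra.
have nd m : nondecreasing_seq (series (fun k => bask m k x)).
  by apply: nondecreasing_series => k *; exact: bask_ge0.
elim: n => [|n IH].
  (* At [n = 0] the coefficient is ['C(k - 1, k)] with truncated subtraction: 1 for [k = 0], 0
     beyond. *)
  rewrite -cvg_shiftS [X in X @ _ --> _](_ : _ = cst 1); first exact: cvg_cst.
  apply/funext => N; rewrite /series/= big_nat_recl//= big1.
    by rewrite /bask bin0 !expr0 addr0 mulr1 divr1.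
  by move=> k _; rewrite /bask add0n subn1/= bin_small// !mul0r.
set s := series (fun k => bask n.+1 k x).
have le1 N : s N <= 1.
  have sN : s N <= s N.+1 by exact: nd.
  have tN : series (fun k => bask n k x) N.+1 <= 1.
    rewrite -(cvg_lim (@Rhausdorff _) IH); apply: nondecreasing_cvgn_le => //.
    by apply/cvg_ex; exists 1.
  (* Inserting the recurrence into [s N <= s N.+1] leaves [s N] at most the partial sum for [n],
     itself at most 1. *)
  move: sN; rewrite {2}/s series_baskS// -/s -lerBlDr.
  rewrite (_ : s N - _ = s N / (1 + x)).
    by rewrite ler_pM2r ?invr_gt0// => /le_trans; apply.
  by field; rewrite gt_eqF.
have /cvg_ex[l sl] : cvgn s.
  by apply: nondecreasing_is_cvgn; [exact: nd|exists 1 => _ [N _ <-]].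
have : (fun N => s N.+1) @ \oo --> 1 / (1 + x) + x / (1 + x) * l.
  rewrite (_ : (fun N => _) = fun N =>
    series (fun k => bask n k x) N.+1 / (1 + x) + x / (1 + x) * s N); last first.
    by apply/funext => N; rewrite /s series_baskS.
  apply: cvgD; last exact: cvgMl_tmp.
  by apply: cvgMr_tmp; rewrite cvg_shiftS.
rewrite cvg_shiftS => /(cvg_unique (@Rhausdorff _) sl) ll.
suff -> : 1 = l by [].
have : l * (1 + x) = 1 + x * l by rewrite {1}ll; field; rewrite gt_eqF.
by lra.
Qed.

(** From [(k+1) C(n+k, k+1) = n C(n+k, k)]. A factor [k] is traded for a shift of both indices, so
    each moment reduces to lower ones at [n + 1]. *)
Lemma bask_shift n k x : 0 <= x ->
  k.+1%:R * bask n k.+1 x = n%:R * x * bask n.+1 k x.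
Proof.
move=> x0; have x1 : 1 + x != 0 by lra.
rewrite /bask !addSn !addnS !subn1/= !exprS !mulrA -natrM mul_bin_left addnK natrM.
by field; rewrite expf_neq0.
Qed.

Lemma cvg_series_bask1 n x : 0 <= x ->
  series (fun k => k%:R * bask n k x) @ \oo --> n%:R * x.
Proof.
move=> x0; rewrite [X in _ --> X](_ : _ = 0%:R * bask n 0 x + n%:R * x);
  last by rewrite mul0r add0r.
apply: (@cvg_series_recl _ (fun k => k%:R * bask n k x)).
have := cvg_series_linear (n%:R * x) 0 _ _ _ _
  (cvg_series_bask n.+1 x x0) (cvg_series_bask 0 x x0).
rewrite mul0r addr0 mulr1; apply: eq_cvg_series => k.
by rewrite mul0r addr0 bask_shift.
Qed.

Lemma cvg_series_bask2 n x : 0 <= x ->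
  series (fun k => k%:R ^+ 2 * bask n k x) @ \oo --> n%:R * x * (n.+1%:R * x + 1).
Proof.
move=> x0; rewrite -[X in _ --> X]add0r -[X in X + _](mul0r (bask n 0 x)).
rewrite -[X in X * bask _ _ _](expr0n R 2).
apply: (@cvg_series_recl _ (fun k => k%:R ^+ 2 * bask n k x)).
have := cvg_series_linear (n%:R * x) (n%:R * x) _ _ _ _
  (cvg_series_bask1 n.+1 x x0) (cvg_series_bask n.+1 x x0).
rewrite -mulrDr; apply: eq_cvg_series => k.
rewrite expr2 -mulrA bask_shift// -[k.+1]addn1 natrD.
by ring.
Qed.

(** Expansion of the square into moments 0, 1 and 2. The shape [a + b (k - n x)^2] is that of the
    kernel error at index [k]. *)
Lemma cvg_series_bask_var n x (a b : R) : 0 <= x ->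
  series (fun k => bask n k x * (a + b * (k%:R - n%:R * x) ^+ 2)) @ \oo -->
  a + b * (n%:R * x * (1 + x)).
Proof.
move=> x0.
have h := cvg_series_linear (a + b * (n%:R * x) ^+ 2) (- (b * 2 * n%:R * x)) _ _ _ _
  (cvg_series_bask n x x0) (cvg_series_bask1 n x x0).
have := cvg_series_linear 1 b _ _ _ _ h (cvg_series_bask2 n x x0).
rewrite [X in _ --> X -> _](_ : _ = a + b * (n%:R * x * (1 + x))); last first.
  by rewrite -[n.+1]addn1 natrD; ring.
by apply: eq_cvg_series => k; ring.
Qed.

(** [C(n+k-3, k-2)] is the coefficient of [bask n (k-2) x], and the powers of [x] and [1 + x] match
    once [(1 - alpha) x] is taken out. *)
Lemma p_basisE (alpha : R) n k x : (0 < n)%N -> 0 <= x ->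
  p_basis alpha n k x = (alpha + (1 - alpha) * (1 + x)) * bask n k x
  - (1 - alpha) * x * (if k is j.+2 then bask n j x else 0).
Proof.
move=> n0 x0; have x1 : 1 + x != 0 by lra.
case: k => [|k]/=.
  (* [n - 1] is truncated subtraction; [0 < n] gives [(1+x)^n = (1+x)^(n-1) (1+x)]. *)
  rewrite /bask bin0 addn0 -[in RHS](subnK n0) exprD expr1.
  by field; rewrite x1 expf_neq0.
rewrite /bask; case: k => [|k].
  by rewrite addnK addn1 (exprS (1 + x)); field; rewrite x1 expf_neq0.
rewrite !addnS !subn1 !subSS /= subn1 !(exprS x) !(exprS (1 + x)).
by field; rewrite x1 expf_neq0.
Qed.

End baskakov.

(** * Beta integrals on [0, 1] *)

Section beta_integrals.
Context {R : realType}.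
Notation mu := (@lebesgue_measure R).
Implicit Types (a b c x t u : R).

(* The maximum is needed because [powR] is constantly 1 on negative bases. *)
Lemma continuous_powR_max a : 0 <= a ->
  continuous (fun u : R => Num.max u 0 `^ a).
Proof.
rewrite le_eqVlt => /predU1P[<-|a0] u.
  rewrite (_ : (fun _ => _) = cst 1); first exact: cst_continuous.
  by apply/funext => v; rewrite powRr0.
have [u0|u0|u0] := ltgtP u 0.
- rewrite /continuous_at (max_idPr (ltW u0)) powR0 ?gt_eqF//.
  apply: (@cvg_trans _ (cst 0 v @[v --> _])); [apply: near_eq_cvg|exact: cvg_cst].
  near=> v; rewrite /cst (max_idPr _) ?powR0 ?gt_eqF//.
  by apply: ltW; near: v; exact: lt_nbhsl.
- rewrite /continuous_at (max_idPl (ltW u0)).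
  apply: (@cvg_trans _ (v `^ a @[v --> u])); first apply: near_eq_cvg.
    near=> v; rewrite (max_idPl _)//.
    by apply: ltW; near: v; exact: lt_nbhsr.
  have /derivable1_diffP/differentiable_continuous : derivable (fun v : R => v `^ a) u 1.
    by apply: derivable_powR; rewrite in_itv/= u0.
  exact.
- rewrite u0; apply/left_right_continuousP; rewrite maxxx powR0 ?gt_eqF//; split.
    apply: (@cvg_trans _ (cst 0 v @[v --> _])); [apply: near_eq_cvg|exact: cvg_cst].
    by near=> v; rewrite /cst (max_idPr _) ?powR0 ?gt_eqF//; apply: ltW.
  apply: (@cvg_trans _ (v `^ a @[v --> 0^'+])); [apply: near_eq_cvg|exact: powR_cvg0].
  by near=> v; rewrite (max_idPl _)//; apply: ltW.
Unshelve. all: by end_near. Qed.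

Definition beta_weight a b u : R := u `^ (a - 1) * (1 - u) `^ (b - 1).

Lemma beta_weight_ge0 a b u : 0 <= beta_weight a b u.
Proof. by rewrite mulr_ge0// powR_ge0. Qed.

Lemma continuous_beta_weight a b : 1 <= a -> 1 <= b ->
  {within `[0, 1], continuous (beta_weight a b)}.
Proof.
move=> a1 b1; pose g u := Num.max u 0 `^ (a - 1) * Num.max (1 - u) 0 `^ (b - 1).
apply: (@subspace_eq_continuous _ _ _ (g : subspace `[0, 1] -> R)).
  move=> u; rewrite inE/= in_itv/= => /andP[u0 u1].
  by rewrite /g !(max_idPl _)// subr_ge0.
apply: continuous_subspaceT => u; apply: cvgM.
  by apply: continuous_powR_max; rewrite subr_ge0.
apply: (@continuous_comp _ _ _ (fun u => 1 - u) (fun v => Num.max v 0 `^ (b - 1))).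
  by apply: cvgB; [exact: cvg_cst|exact: cvg_id].
by apply: continuous_powR_max; rewrite subr_ge0.
Qed.

Lemma integrable_beta_weight a b : 1 <= a -> 1 <= b ->
  mu.-integrable `[0, 1] (EFin \o beta_weight a b).
Proof.
move=> a1 b1; apply: continuous_compact_integrable; first exact: segment_compact.
exact: continuous_beta_weight.
Qed.

Lemma BetaE a b : 1 <= a -> 1 <= b ->
  Beta a b = \int[mu]_(u in `[0, 1]) beta_weight a b u.
Proof.
move=> a1 b1; rewrite /Beta /Rintegral.
rewrite [in RHS]integral_itv_bndoo//.
apply: measurable_funS (measurable_int _ (integrable_beta_weight a b a1 b1)) => //.
exact: subset_itv_oo_cc.
Qed.

Lemma EFin_Beta a b : 1 <= a -> 1 <= b ->
  (\int[mu]_(u in `[0%R, 1%R]) (beta_weight a b u)%:E = (Beta a b)%:E)%E.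
Proof.
move=> a1 b1; rewrite BetaE// /Rintegral fineK//.
by apply: integrable_fin_num => //; exact: integrable_beta_weight.
Qed.

Lemma Beta_gt0 a b : 1 <= a -> 1 <= b -> 0 < Beta a b.
Proof.
(* On [[1/4, 3/4]] both [u] and [1 - u] are at least 1/4, so [c] is a lower bound of the weight
   there. *)
move=> a1 b1; pose c : R := 4^-1 `^ (a - 1) * 4^-1 `^ (b - 1).
have c0 : 0 < c by rewrite mulr_gt0// powR_gt0.
rewrite -lte_fin -EFin_Beta//.
apply: (@lt_le_trans _ _ (\int[mu]_(u in `[4^-1%R, (1 - 4^-1)%R]) (cst c%:E u))%E).
  rewrite integral_cst//= lebesgue_measure_itv/= lte_fin ifT; last by lra.
  by rewrite -EFinM lte_fin mulr_gt0//; lra.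
apply: (@le_trans _ _ (\int[mu]_(u in `[4^-1%R, (1 - 4^-1)%R]) (beta_weight a b u)%:E)%E).
  apply: ge0_le_integral => //=.
  - by move=> *; rewrite lee_fin ltW.
  - apply: measurable_funS (measurable_int _ (integrable_beta_weight a b a1 b1)) => //.
    by apply: subset_itv; rewrite bnd_simp; lra.
  - move=> u; rewrite in_itv/= => /andP[u0 u1]; rewrite lee_fin.
    by apply: ler_pM; rewrite ?powR_ge0// ge0_ler_powR// ?nnegrE; lra.
apply: ge0_subset_integral => //.
- exact: measurable_int (integrable_beta_weight a b a1 b1).
- by move=> *; rewrite lee_fin beta_weight_ge0.
- by apply: subset_itv; rewrite bnd_simp; lra.
Qed.

(** The function [u^a (1-u)^b] vanishes at both ends, so the integral of its derivative,
    [a Beta(a,b) - (a+b) Beta(a+1,b)], is 0. *)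
Lemma BetaS a b : 1 <= a -> 1 <= b -> Beta (a + 1) b = a / (a + b) * Beta a b.
Proof.
move=> a1 b1; have [a0 b0 a2] : [/\ 0 < a, 0 < b & 1 <= a + 1] by split; lra.
pose F u := u `^ a * (1 - u) `^ b.
pose f u := a * beta_weight a b u - (a + b) * beta_weight (a + 1) b u.
have dF u : 0 < u -> u < 1 -> is_derive u 1 F (f u).
  move=> u0 u1; have v0 : 0 < 1 - u by lra.
  have d1 : is_derive u 1 (fun v : R => v `^ a) (a * u `^ (a - 1)).
    exact: is_derive1_powR.
  have d2 : is_derive u 1 (fun u : R => (1 - u) `^ b) (- (b * (1 - u) `^ (b - 1))).
    have e1 : is_derive u 1 (fun u : R => 1 - u) (-1).
      by apply: is_derive_eq; rewrite add0r mul1r.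
    have e2 : is_derive (1 - u) 1 (fun v : R => v `^ b) (b * (1 - u) `^ (b - 1)).
      exact: is_derive1_powR.
    by have := @is_derive1_comp _ (fun v => v `^ b) (fun u => 1 - u) _ _ _ e2 e1;
      rewrite mulrN1.
  have d12 : is_derive u 1 F _ := is_deriveM d1 d2.
  apply: (is_derive_eq d12); rewrite /f /beta_weight addrK /GRing.scale/=
    -(mulr_powRB1 (ltW v0) b0) -(mulr_powRB1 (ltW u0) a0).
  by ring.
have cf : {within `[0, 1], continuous f}.
  have c1 := continuous_beta_weight a b a1 b1.
  have c2 := continuous_beta_weight _ b a2 b1.
  move=> u; apply: cvgB; apply: cvgMl_tmp; [exact: c1|exact: c2].
have F0 : F 0 = 0 by rewrite /F powR0 ?mul0r//; lra.
have F1 : F 1 = 0 by rewrite /F subrr powR0 ?mulr0//; lra.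
(* [F] is itself a Beta weight, with parameters [a + 1] and [b + 1]. *)
have cF : {within `[0, 1], continuous F}.
  have := @continuous_beta_weight (a + 1) (b + 1) a2 _.
  by rewrite /beta_weight !addrK; apply; lra.
have [_ Fr Fl] := (@continuous_within_itvP R _ _ _ _ F ltr01).1 cF.
have Fd : derivable_oo_LRcontinuous F 0 1.
  by split => // u; rewrite in_itv/= => /andP[u0 u1];
    exact: (@ex_derive _ _ _ _ _ _ _ (dF u u0 u1)).
have := continuous_FTC2 ltr01 cf Fd _.
rewrite F0 F1 sube0 => h.
have : \int[mu]_(u in `[0, 1]) f u = 0.
  rewrite /Rintegral h// => u; rewrite in_itv/= => /andP[u0 u1].
  by rewrite derive1E; exact: (@derive_val _ _ _ _ _ _ _ (dF u u0 u1)).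
have i1 := integrable_beta_weight a b a1 b1.
have i2 := integrable_beta_weight _ b a2 b1.
have iZ (c : R) g : mu.-integrable `[0%R, 1%R] (EFin \o g) ->
    mu.-integrable `[0, 1] (EFin \o (fun u => c * g u)).
  by move=> ig; exact: (integrableZl _ c ig).
rewrite RintegralB//; [|exact: iZ|exact: iZ].
rewrite !RintegralZl// -!BetaE// => e.
have ab : a + b != 0 by lra.
by apply: (mulfI ab); rewrite mulrA mulrCA divff// mulr1; lra.
Qed.

End beta_integrals.

(** * The substitution u = t/(1+t) and the beta prime weight *)

Section beta_prime.
Context {R : realType}.
Notation mu := (@lebesgue_measure R).
Implicit Types (a b c x t u : R).

(** The probability whose odds are [t]; it maps [[0, oo[] bijectively onto [[0, 1[]. *)
Definition odds t : R := t / (1 + t).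

Lemma odds_ge0 t : 0 <= t -> 0 <= odds t.
Proof. by move=> t0; rewrite divr_ge0//; lra. Qed.

Lemma odds_gt0 t : 0 < t -> 0 < odds t.
Proof. by move=> t0; rewrite divr_gt0//; lra. Qed.

Lemma odds_lt1 t : 0 <= t -> odds t < 1.
Proof. by move=> t0; rewrite ltr_pdivrMr; lra. Qed.

Lemma onem_odds t : 0 <= t -> 1 - odds t = (1 + t)^-1.
Proof. by move=> t0; rewrite /odds; field; lra. Qed.

Lemma is_derive_odds t : 0 < t -> is_derive t 1 odds ((1 + t) ^- 2).
Proof.
move=> t0; have t1 : 1 + t != 0 by lra.
have d1 : is_derive t 1 (fun t : R => 1 + t) 1.
  by apply: is_derive_eq; rewrite add0r mulr1.
have d2 := is_deriveV t1 d1.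
have d3 : is_derive t 1 odds _ := is_deriveM (is_derive_id t 1) d2.
by apply: (is_derive_eq d3); rewrite /GRing.scale/=; field.
Qed.

Lemma cvg_odds_at_right : odds t @[t --> 0^'+] --> (0 : R).
Proof.
have : {for 0, continuous odds}.
  apply: cvgM; first exact: cvg_id.
  by apply: cvgV; [rewrite addr0 oner_neq0|apply: cvgD; [exact: cvg_cst|exact: cvg_id]].
have o0 : odds 0 = 0 by rewrite /odds mul0r.
by move=> oc; rewrite -[X in _ --> X]o0; exact: cvg_at_right_filter.
Qed.

Lemma cvg_odds_pinfty : odds t @[t --> +oo%R] --> 1^'-.
Proof.
move=> P [e /= e0 eP]; exists e^-1; split; first by rewrite num_real.
move=> t et; have t0 : 0 < t by apply: lt_trans et; rewrite invr_gt0.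
apply: eP => /=; last by rewrite odds_lt1// ltW.
rewrite onem_odds ?(ltW t0)// ger0_norm; last by rewrite invr_ge0; lra.
rewrite invf_plt ?posrE//; first by lra.
by lra.
Qed.

(** Unnormalised beta prime density with parameters [a + 1] and [b]; [a = k rho] and [b = n rho]
    give the shape of [mu_kernel]. *)
Definition beta_prime_weight a b t : R := t `^ a / (1 + t) `^ (b + a + 1).

Lemma beta_prime_weight_ge0 a b t : 0 <= beta_prime_weight a b t.
Proof. by rewrite divr_ge0// powR_ge0. Qed.

(** Change of variables: [(1 + t)^-2] is the derivative of [odds]. *)
Lemma beta_prime_weightE a b t : 0 < t ->
  beta_prime_weight a b t = beta_weight (a + 1) b (odds t) * (1 + t) ^- 2.
Proof.
move=> t0; have t1 : 0 < 1 + t by lra.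
have powV p : (1 + t)^-1 `^ p = (1 + t) `^ (- p).
  by rewrite -powR_inv1 ?(ltW t1)// -powRrM mulN1r.
rewrite /beta_weight addrK onem_odds ?(ltW t0)// powRM ?invr_ge0 ?(ltW t0) ?(ltW t1)//.
rewrite !powV -powR_invn ?(ltW t1)// /beta_prime_weight -powRN -!mulrA.
rewrite -!powRD ?(gt_eqF t1) ?implybT//.
by congr (_ * _ `^ _); ring.
Qed.

(** The family is stable under multiplication by [odds], so moments of [odds] are again Beta
    integrals. *)
Lemma beta_prime_weightS a b t : 0 <= a -> 0 <= t ->
  odds t * beta_prime_weight a b t = beta_prime_weight (a + 1) b t.
Proof.
move=> a0; rewrite le_eqVlt => /predU1P[<-|t0].
  by rewrite /odds !mul0r /beta_prime_weight powR0 ?mul0r//; lra.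
have t1 : 0 < 1 + t by lra.
rewrite !beta_prime_weightE// mulrA; congr (_ * _).
rewrite /beta_weight mulrA !addrK; congr (_ * _).
by rewrite powRD ?powRr1 ?odds_ge0 ?(ltW t0) 1?mulrC//;
  rewrite (gt_eqF (odds_gt0 _ _))// implybT.
Qed.

Lemma continuous_beta_prime_weight a b : 0 <= a -> 0 <= b ->
  {within `[0, +oo[, continuous (beta_prime_weight a b)}.
Proof.
move=> a0 b0; have c0 : 0 <= b + a + 1 by lra.
pose g t := Num.max t 0 `^ a / Num.max (1 + t) 0 `^ (b + a + 1).
apply: (@subspace_eq_continuous _ _ _ (g : subspace `[0, +oo[ -> R)).
  move=> t; rewrite inE/= in_itv/= andbT => t0.
  by rewrite /g !(max_idPl _)// addr_ge0.
apply: continuous_in_subspaceT => t; rewrite inE/= in_itv/= andbT => t0.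
apply: cvgM; first exact: continuous_powR_max.
apply: cvgV.
  by rewrite powR_eq0 negb_and (max_idPl _) ?gt_eqF//; lra.
apply: (@continuous_comp _ _ _ (fun u => 1 + u) (fun v => Num.max v 0 `^ (b + a + 1))).
  by apply: cvgD; [exact: cvg_cst|exact: cvg_id].
exact: continuous_powR_max.
Qed.

(* The substitution u = t / (1 + t) is carried out on primitives: the
   integrand is the derivative of the incomplete Beta integral at odds t. *)
Lemma integral_beta_prime_weight a b : 0 <= a -> 1 <= b ->
  (\int[mu]_(t in halfline) (beta_prime_weight a b t)%:E = (Beta (a + 1) b)%:E)%E.
Proof.
move=> a0 b1; have a1 : 1 <= a + 1 by lra.
have iw := integrable_beta_weight _ _ a1 b1.
pose B u := parameterized_integral mu 0 u (beta_weight (a + 1) b).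
have B0 : B 0 = 0 by rewrite /B /parameterized_integral set_itv1 Rintegral_set1.
have dBo t : 0 < t -> is_derive t 1 (B \o odds) (beta_prime_weight a b t).
  move=> t0; rewrite beta_prime_weightE//.
  have o0 := odds_gt0 _ t0; have o1 := odds_lt1 _ (ltW t0).
  suff dB : is_derive (odds t) 1 B (beta_weight (a + 1) b (odds t)).
    exact: is_derive1_comp dB (is_derive_odds _ t0).
  have [Bo _ _] :=
    (@continuous_within_itvP _ _ _ _ _ _ ltr01).1 (continuous_beta_weight _ _ a1 b1).
  have wo : {for odds t, continuous (beta_weight (a + 1) b)}.
    by apply: Bo; rewrite in_itv/= o0.
  have [dB BE] := continuous_FTC1_closed o1 iw o0 wo.
  by split => //; rewrite -derive1E.
rewrite (@ge0_continuous_FTC2y _ _ (B \o odds) 0 (Beta (a + 1) b)).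
- by rewrite /= /odds mul0r B0 sube0.
- by move=> *; exact: beta_prime_weight_ge0.
- by apply: continuous_beta_prime_weight => //; lra.
- apply: (@cvg_comp _ _ _ odds B); first exact: cvg_odds_pinfty.
  by rewrite BetaE//; exact: parameterized_integral_cvg_at_left.
- by move=> t /dBo d; exact: (@ex_derive _ _ _ _ _ _ _ d).
- rewrite /= /odds mul0r B0; apply: (@cvg_comp _ _ _ odds B).
    exact: cvg_odds_at_right.
  exact: parameterized_integral_cvg_left iw.
- move=> t; rewrite in_itv/= andbT => /dBo d.
  by rewrite derive1E; exact: (@derive_val _ _ _ _ _ _ _ d).
Qed.

End beta_prime.

(** * Mean and variance of [odds] under the beta prime density *)

Section beta_prime_mean.
Context {R : realType}.
Notation mu := (@lebesgue_measure R).
Implicit Types (a b s t y e C : R) (f : R -> R).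

Lemma measurable_halfline : measurable (halfline : set (measurableTypeR R)).
Proof. exact: measurable_itv. Qed.

Lemma halfline_ge0 t : halfline t -> 0 <= t.
Proof. by rewrite /halfline/= in_itv/= andbT. Qed.

Lemma integrable_beta_prime_weight a b : 0 <= a -> 1 <= b ->
  mu.-integrable halfline (EFin \o beta_prime_weight a b).
Proof.
move=> a0 b1; apply/integrableP; split.
  apply/measurable_EFinP; apply: subspace_continuous_measurable_fun.
    exact: measurable_halfline.
  by apply: continuous_beta_prime_weight => //; lra.
under eq_integral do rewrite /= ger0_norm ?beta_prime_weight_ge0//.
by rewrite integral_beta_prime_weight// ltry.
Qed.

Lemma Rintegral_beta_prime_weight a b : 0 <= a -> 1 <= b ->
  \int[mu]_(t in halfline) beta_prime_weight a b t = Beta (a + 1) b.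
Proof. by move=> a0 b1; rewrite /Rintegral integral_beta_prime_weight. Qed.

Definition beta_prime_pdf a b t := beta_prime_weight a b t / Beta (a + 1) b.

Lemma beta_prime_pdf_ge0 a b t : 0 <= a -> 1 <= b -> 0 <= beta_prime_pdf a b t.
Proof.
move=> a0 b1; rewrite divr_ge0 ?beta_prime_weight_ge0// ltW// Beta_gt0//; lra.
Qed.

Lemma integrable_beta_prime_pdf a b : 0 <= a -> 1 <= b ->
  mu.-integrable halfline (EFin \o beta_prime_pdf a b).
Proof.
move=> a0 b1; have i0 := integrable_beta_prime_weight a b a0 b1.
exact: (integrableZr measurable_halfline (Beta (a + 1) b)^-1 i0).
Qed.

Lemma Rintegral_beta_prime_pdf a b : 0 <= a -> 1 <= b ->
  \int[mu]_(t in halfline) beta_prime_pdf a b t = 1.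
Proof.
move=> a0 b1; rewrite RintegralZr; last 2 first.
- exact: measurable_halfline.
- exact: integrable_beta_prime_weight.
by rewrite Rintegral_beta_prime_weight// divff// gt_eqF// Beta_gt0//; lra.
Qed.

(** The factor, which comes from [BetaS], is the mean of the Beta law with parameters [a + 1] and
    [b]. *)
Lemma beta_prime_pdfS a b t : 0 <= a -> 1 <= b -> 0 <= t ->
  odds t * beta_prime_pdf a b t =
  (a + 1) / (a + b + 1) * beta_prime_pdf (a + 1) b t.
Proof.
move=> a0 b1 t0; rewrite /beta_prime_pdf mulrA beta_prime_weightS// (BetaS (a + 1))//;
  last by lra.
have B0 : Beta (a + 1) b != 0 by rewrite gt_eqF// Beta_gt0//; lra.
by field; rewrite B0/=; apply/andP; split; lra.
Qed.

(** Expanding the square and applying [beta_prime_pdfS] once or twice leaves a combination of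
    densities, each integrable with integral 1. *)
Lemma beta_prime_pdf_deviation a b s t : 0 <= a -> 1 <= b -> 0 <= t ->
  beta_prime_pdf a b t * (odds t - s) ^+ 2 =
  s ^+ 2 * beta_prime_pdf a b t +
  (- (2 * s * ((a + 1) / (a + b + 1))) * beta_prime_pdf (a + 1) b t +
  (a + 1) / (a + b + 1) * ((a + 2) / (a + b + 2)) * beta_prime_pdf (a + 2) b t).
Proof.
move=> a0 b1 t0; have a1 : 0 <= a + 1 by lra.
have := beta_prime_pdfS a b t a0 b1 t0; have := beta_prime_pdfS (a + 1) b t a1 b1 t0.
rewrite (_ : a + 1 + 1 = a + 2); last by ring.
rewrite (_ : a + 1 + b + 1 = a + b + 2); last by ring.
set m1 := (a + 1) / (a + b + 1); set m2 := (a + 2) / (a + b + 2) => e2 e1.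
have -> : m1 * m2 * beta_prime_pdf (a + 2) b t = odds t ^+ 2 * beta_prime_pdf a b t.
  by rewrite -mulrA -e2 mulrCA -e1 mulrA.
have -> : - (2 * s * m1) * beta_prime_pdf (a + 1) b t =
    - (2 * s) * (odds t * beta_prime_pdf a b t) by rewrite e1; ring.
by ring.
Qed.

Lemma integrable_beta_prime_pdf_deviation a b s : 0 <= a -> 1 <= b ->
  mu.-integrable halfline (EFin \o 
    (fun t => beta_prime_pdf a b t * (odds t - s) ^+ 2)).
Proof.
move=> a0 b1; have mH := measurable_halfline.
have iZ (c : R) a' : 0 <= a' ->
    mu.-integrable halfline (EFin \o (fun t => c * beta_prime_pdf a' b t)).
  by move=> a'0; exact: (integrableZl mH c (integrable_beta_prime_pdf _ _ a'0 b1)).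
have a2 : 0 <= a + 2 by lra.
have a1 : 0 <= a + 1 by lra.
have := integrableD mH (iZ (s ^+ 2) _ a0)
  (integrableD mH (iZ (- (2 * s * ((a + 1) / (a + b + 1)))) _ a1)
    (iZ ((a + 1) / (a + b + 1) * ((a + 2) / (a + b + 2))) _ a2)).
apply: eq_integrable => //.
by move=> t; rewrite inE => /halfline_ge0 t0 /=; rewrite beta_prime_pdf_deviation.
Qed.

(** Squared bias plus variance of the Beta law with parameters [a + 1] and [b]. *)
Lemma Rintegral_beta_prime_pdf_deviation a b s : 0 <= a -> 1 <= b ->
  \int[mu]_(t in halfline) (beta_prime_pdf a b t * (odds t - s) ^+ 2) =
  ((a + 1) / (a + b + 1) - s) ^+ 2
  + (a + 1) * b / ((a + b + 1) ^+ 2 * (a + b + 2)).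
Proof.
move=> a0 b1; have mH := measurable_halfline.
have a2 : 0 <= a + 2 by lra.
have a1 : 0 <= a + 1 by lra.
have iP a' : 0 <= a' -> mu.-integrable halfline (EFin \o beta_prime_pdf a' b).
  by move=> a'0; exact: integrable_beta_prime_pdf.
have iZ (c : R) a' : 0 <= a' ->
    mu.-integrable halfline (EFin \o (fun t => c * beta_prime_pdf a' b t)).
  by move=> a'0; exact: (integrableZl mH c (iP _ a'0)).
under eq_Rintegral.
  by move=> t; rewrite inE => /halfline_ge0 t0;
    rewrite beta_prime_pdf_deviation//; over.
rewrite RintegralD//; [|exact: iZ|exact: (integrableD mH (iZ _ _ a1) (iZ _ _ a2))].
rewrite RintegralD//; [|exact: iZ|exact: iZ].
rewrite !RintegralZl//; [|exact: iP|exact: iP|exact: iP].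
rewrite !Rintegral_beta_prime_pdf//.
by field; apply/andP; split; lra.
Qed.

(** As the density has mass 1, the difference is the integral of the density times [f - y]; the
    hypothesis reduces it to the second moment of [odds t - s]. *)
Lemma beta_prime_mean_dist a b s f y e C : 0 <= a -> 1 <= b -> 0 <= C ->
  measurable_fun halfline f ->
  (forall t, 0 <= t -> `|f t - y| <= e + C * (odds t - s) ^+ 2) ->
  `|\int[mu]_(t in halfline) (beta_prime_pdf a b t * f t) - y| <=
  e + C * (((a + 1) / (a + b + 1) - s) ^+ 2 + b^-1).
Proof.
move=> a0 b1 C0 mf fy; have mH := measurable_halfline.
have iP := integrable_beta_prime_pdf a b a0 b1.
have iD := integrable_beta_prime_pdf_deviation a b s a0 b1.
have iZ (c : R) (g : R -> R) : mu.-integrable halfline (EFin \o g) ->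
    mu.-integrable halfline (EFin \o (fun t => c * g t)).
  by move=> ig; exact: (integrableZl mH c ig).
have mP : measurable_fun halfline (beta_prime_pdf a b).
  by apply/measurable_EFinP; exact: measurable_int iP.
pose g t := e * beta_prime_pdf a b t + C * (beta_prime_pdf a b t * (odds t - s) ^+ 2).
have ig : mu.-integrable halfline (EFin \o g).
  exact: (integrableD mH (iZ e _ iP) (iZ C _ iD)).
pose h t := beta_prime_pdf a b t * (f t - y).
have hg t : 0 <= t -> `|h t| <= g t.
  move=> t0; rewrite /h /g normrM ger0_norm ?beta_prime_pdf_ge0//.
  rewrite (_ : e * _ + _ = beta_prime_pdf a b t * (e + C * (odds t - s) ^+ 2));
    last by ring.
  by rewrite ler_wpM2l ?beta_prime_pdf_ge0// fy.
have mh : measurable_fun halfline h.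
  by apply: measurable_funM => //; apply: measurable_funB => //;
    exact: measurable_cst.
have ih : mu.-integrable halfline (EFin \o h).
  apply: le_integrable ig => //; first exact/measurable_EFinP.
  move=> t /halfline_ge0 t0 /=; rewrite lee_fin (le_trans (hg t t0))//.
  exact: ler_norm.
have -> : \int[mu]_(t in halfline) (beta_prime_pdf a b t * f t) =
    \int[mu]_(t in halfline) h t + y.
  transitivity (\int[mu]_(t in halfline) (h t + y * beta_prime_pdf a b t)).
    by apply: eq_Rintegral => t _; rewrite /h; ring.
  rewrite RintegralD//; last exact: iZ.
  by rewrite RintegralZl// Rintegral_beta_prime_pdf// mulr1.
rewrite addrK (le_trans (le_normr_Rintegral mH ih))//.
have inh : mu.-integrable halfline (EFin \o (fun t => `|h t|)).
  exact: integrable_norm ih.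
apply: (@le_trans _ _ (\int[mu]_(t in halfline) g t)).
  by apply: le_Rintegral => // t /halfline_ge0; exact: hg.
rewrite /g RintegralD//; [|exact: iZ|exact: iZ].
rewrite !RintegralZl// Rintegral_beta_prime_pdf// mulr1
  Rintegral_beta_prime_pdf_deviation//.
(* The variance is at most [1/b], from [b^2 <= (a+b+1)^2] and [a+1 <= a+b+2]. *)
rewrite lerD2l ler_wpM2l// lerD2l ler_pdivrMr;
  last by rewrite !mulr_gt0 ?exprn_gt0//; lra.
rewrite [leRHS]mulrC ler_pdivlMr; last lra.
by rewrite -mulrA mulrC ler_pM//; nra.
Qed.

End beta_prime_mean.

(** * Korovkin estimate for f and bias of the kernels *)

Section convergence.
Context {R : realType}.
Implicit Types (alpha rho A M x t e C : R) (f : R -> R) (n k : nat).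

Lemma mu_kernelE rho n k t :
  mu_kernel rho n k t = beta_prime_pdf (k%:R * rho) (n%:R * rho) t.
Proof.
by rewrite /mu_kernel /beta_prime_pdf /beta_prime_weight invfM mulrA mulrAC.
Qed.

Lemma continuous_halflineP f : {within halfline, continuous f} ->
  forall x e, 0 <= x -> 0 < e ->
  exists2 d : R, 0 < d & forall t, 0 <= t -> `|t - x| < d -> `|f t - f x| < e.
Proof.
move=> /subspace_continuousP cf x e x0 e0.
have Hx : halfline x by rewrite /halfline/= in_itv/= x0.
have /cvgrPdist_lt/(_ e e0) := cf x Hx.
rewrite near_withinE => -[d /= d0 dP]; exists d => // t t0 tx.
rewrite distrC; apply: dP; first by rewrite /= distrC.
by rewrite /halfline/= in_itv/= t0.
Qed.

(** Only [x] is confined to [[0, A]] while [t] runs over the half-line, hence a covering argument in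
    [x]. *)
Lemma uniformly_continuous_halfline f A e :
  {within halfline, continuous f} -> 0 < e ->
  exists2 d : R, 0 < d & forall x t, 0 <= x -> x <= A -> 0 <= t -> `|t - x| < d ->
    `|f t - f x| < e.
Proof.
move=> cf e0.
have := (compact_near_coveringP `[0, A]).1 (@segment_compact R 0 A) _
  (at_right (0 : R)) (fun d x => 0 <= x -> forall t, 0 <= t -> `|t - x| < d ->
    `|f t - f x| < e) _.
have e2 : 0 < e / 2 by lra.
case=> [x|d/= d0 dP].
  rewrite /= in_itv/= => /andP[x0 _].
  have [d d0 dP] := continuous_halflineP f cf x (e / 2) x0 e2.
  (* If [y] is within [d/2] of [x] and [t] within [d/2] of [y], both are within [d] of [x], and two
     errors [e/2] add up. *)
  exists (ball x (d / 2), [set r | 0 < r < d / 2]) => /=.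
    split; first by apply: nbhsx_ballx; lra.
    exists (d / 2) => /=; first by lra.
    by move=> r /=; rewrite sub0r normrN => + r0; rewrite gtr0_norm// r0.
  move=> [y r] /= [yx /andP[r0 rd]] y0 t t0 ty.
  have h1 := dP y y0 _; have h2 := dP t t0 _.
  have yx' : `|y - x| < d / 2 by rewrite distrC.
  have tx : `|t - x| < d.
    by rewrite (le_lt_trans (ler_distD y _ _))//; lra.
  rewrite (le_lt_trans (ler_distD (f x) _ _))// [X in _ + X]distrC.
  by have := h1 (lt_trans yx' _); have := h2 tx; lra.
exists (d / 2); first by lra.
move=> x t x0 xA t0 tx; apply: (dP (d / 2)) tx => //=; last by rewrite in_itv/= x0.
  by rewrite sub0r normrN gtr0_norm; lra.
by lra.
Qed.

(* Korovkin-type estimate with the bounded test functions 1, odds, odds^2, so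
   that no moment of the kernel in t itself is needed. *)
Lemma korovkin_odds f A M e : {within halfline, continuous f} ->
  (forall t, 0 <= t -> `|f t| <= M) -> 0 < A -> 0 < e ->
  exists2 C : R, 0 <= C & forall x t, 0 <= x -> x <= A -> 0 <= t ->
    `|f t - f x| <= e + C * (odds t - odds x) ^+ 2.
Proof.
move=> cf fM A0 e0; have [d d0 dP] := uniformly_continuous_halfline f A e cf e0.
have M0 : 0 <= M by rewrite (le_trans _ (fM 0 _)).
(* [c] is the least value of [|odds t - odds x| = |t - x| / ((1+t)(1+x))] for [|t - x| >= d],
   reached at [x = A], [t = A + d]. With [2M / c^2] the quadratic term then dominates the crude
   bound [2M]. *)
pose c := d / ((1 + A) * (1 + A + d)).
have c0 : 0 < c by rewrite divr_gt0// mulr_gt0//; lra.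
have C0 : 0 <= 2 * M / c ^+ 2 by apply: divr_ge0; [lra|exact: exprn_ge0 (ltW c0)].
exists (2 * M / c ^+ 2) => //.
move=> x t x0 xA t0; have [tx|tx] := ltP `|t - x| d.
  rewrite (le_trans (ltW (dP x t x0 xA t0 tx)))// lerDl.
  by rewrite mulr_ge0 ?sqr_ge0.
have fd : `|f t - f x| <= 2 * M.
  by rewrite (le_trans (ler_normB _ _))//; have := fM t t0; have := fM x x0; lra.
have cc : c <= `|odds t - odds x|.
  have -> : odds t - odds x = (t - x) / ((1 + t) * (1 + x)).
    by rewrite /odds; field; lra.
  rewrite normrM [`|_^-1|]ger0_norm; last by rewrite invr_ge0 mulr_ge0//; lra.
  rewrite /c ler_pdivrMr; last by rewrite mulr_gt0//; lra.
  rewrite mulrAC ler_pdivlMr; last by rewrite mulr_gt0//; lra.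
  move: tx; have [xt|xt] := leP x t.
    rewrite ger0_norm ?subr_ge0// => tx.
    (* With [s = t - x >= d] this is [d (1+x+s) <= s (1+x+d)]: the quotient [s/(1+x+s)] increases in
       [s]. *)
    apply: (@le_trans _ _ ((t - x) * ((1 + x + d) * (1 + x)))).
      by rewrite !mulrA ler_wpM2r//; [lra|nra].
    by rewrite ler_wpM2l//; [lra|rewrite mulrC ler_pM//; lra].
  rewrite ltr0_norm ?subr_lt0// => tx.
  by rewrite ler_pM//;
    [exact: ltW|rewrite mulr_ge0//; lra|rewrite mulrC ler_pM//; lra].
have cc2 : c ^+ 2 <= (odds t - odds x) ^+ 2.
  by rewrite -[leRHS]real_normK ?num_real// ler_sqr ?nnegrE// ltW.
have := ler_wpM2l C0 cc2; rewrite divfK ?expf_neq0 ?gt_eqF//.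
by move: fd; lra.
Qed.

(** [N], [K], [J] stand for [n], [k] and the index shift 0 or 2. The mean is within O(1/N) of
    [q = K/(N+K)], the value of [odds] at [K/N]; [q] is then compared with [odds x], and
    [(u+v)^2 <= 2u^2 + 2v^2] joins the two. *)
Lemma beta_mean_dist rho (N K J x : R) : 0 < rho -> 1 <= N -> 0 <= K ->
  0 <= J -> J <= 2 -> 0 <= x ->
  (((K + J) * rho + 1) / ((K + J) * rho + N * rho + 1) - odds x) ^+ 2
  + (N * rho)^-1
  <= 2 / N ^+ 2 * (K - N * x) ^+ 2
     + (2 * ((2 * rho + 1) / rho) ^+ 2 + rho^-1) / N.
Proof.
move=> rho0 N1 K0 J0 J2 x0; have N0 : 0 < N by lra.
have Nr : 0 < N * rho by rewrite mulr_gt0.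
have Kr : 0 <= (K + J) * rho by rewrite mulr_ge0//; lra.
set m := ((K + J) * rho + 1) / _; pose q := K / (N + K).
have mq : 0 <= m - q <= (2 * rho + 1) / rho / N.
  have -> : m - q = (J * rho * N + N) / (((K + J) * rho + N * rho + 1) * (N + K)).
    by rewrite /m /q; field; lra.
  apply/andP; split.
    by rewrite divr_ge0 ?addr_ge0 ?mulr_ge0//; lra.
  rewrite (_ : _ / rho / N = (2 * rho + 1) * N / (N * (N * rho)));
    last by field; lra.
  apply: ler_pM.
  - by rewrite addr_ge0 ?mulr_ge0//; lra.
  - by rewrite invr_ge0 mulr_ge0//; lra.
  - by nra.
  - rewrite lef_pV2 ?posrE; [by nra|by rewrite mulr_gt0//; lra|by rewrite mulr_gt0].
have qx : (q - odds x) ^+ 2 <= (K - N * x) ^+ 2 / N ^+ 2.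
  have -> : q - odds x = (K - N * x) / ((N + K) * (1 + x)).
    by rewrite /q /odds; field; lra.
  rewrite expr_div_n ler_wpM2l ?sqr_ge0// lef_pV2 ?posrE ?exprn_gt0//; last first.
    by rewrite mulr_gt0; lra.
  by rewrite ler_sqr ?nnegrE ?mulr_ge0//; nra.
have mq2 : (m - q) ^+ 2 <= ((2 * rho + 1) / rho) ^+ 2 / N.
  have /andP[mq0 mq1] := mq.
  have c0 : 0 <= (2 * rho + 1) / rho by rewrite divr_ge0//; lra.
  apply: (@le_trans _ _ (((2 * rho + 1) / rho / N) ^+ 2)).
    by rewrite ler_sqr ?nnegrE// divr_ge0//; lra.
  rewrite expr_div_n ler_wpM2l ?sqr_ge0// lef_pV2 ?posrE ?exprn_gt0//.
  by nra.
have -> : m - odds x = (m - q) + (q - odds x) by ring.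
have := sqr_ge0 ((m - q) - (q - odds x)).
rewrite invfM (_ : _ / N =
  2 * (((2 * rho + 1) / rho) ^+ 2 / N) + N^-1 * rho^-1); last by ring.
rewrite (_ : 2 / _ * _ = 2 * ((K - N * x) ^+ 2 / N ^+ 2)); last by ring.
by nra.
Qed.

End convergence.

(** * The alpha-operator as a difference of positive operators *)

Section alpha_series.
Context {R : realType}.
Implicit Types (alpha x y e b : R) (F : R^nat) (n : nat).

(** Let [m0] and [m2] be the Baskakov averages of [F k - y] and [F (k+2) - y]. As [c1 - c2 = 1],
    constants are reproduced and the error is [c1 m0 - c2 m2], while [c1 + c2 <= 1 + 2x]. *)
Lemma series_p_basis_dist alpha n x F y e b :
  0 <= alpha -> alpha <= 1 -> (0 < n)%N -> 0 <= x ->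
  (forall k, `|F k - y| <= e + b * (k%:R - n%:R * x) ^+ 2) ->
  (forall k, `|F k.+2 - y| <= e + b * (k%:R - n%:R * x) ^+ 2) ->
  `|limn (series (fun k => p_basis alpha n k x * F k)) - y| <=
  (1 + 2 * x) * (e + b * (n%:R * x * (1 + x))).
Proof.
move=> al0 al1 n0 x0 F0 F2.
have V0 k : 0 <= bask n k x by exact: bask_ge0.
have Vb := cvg_series_bask_var n x e b x0.
have V1 := cvg_series_bask n x x0.
set c1 := alpha + (1 - alpha) * (1 + x); set c2 := (1 - alpha) * x.
(* Two leading zeros reindex the [k - 2] terms without changing the limit. *)
pose shift2 (u : R^nat) k := if k is j.+2 then u j else 0.
have shift2_cvg (u : R^nat) (l : R) :
    series u @ \oo --> l -> series (shift2 u) @ \oo --> l.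
  move=> ul; rewrite -[l]add0r; apply: (@cvg_series_recl _ (shift2 u)).
  by rewrite -[l]add0r; exact: (@cvg_series_recl _ (fun k => shift2 u k.+1)).
have [m0 s0 m0le] := series_weighted_le _ _ _ _ V0 F0 Vb.
have [m2 s2 m2le] := series_weighted_le _ _ _ _ V0 F2 Vb.
set Q := e + _ in m0le m2le *.
have h1 := cvg_series_linear c1 (c1 * y) _ _ _ _ s0 V1.
have h2 := cvg_series_linear c2 (c2 * y) _ _ _ _
  (shift2_cvg _ _ s2) (shift2_cvg _ _ V1).
have h := cvg_series_linear 1 (-1) _ _ _ _ h1 h2.
have -> : limn (series (fun k => p_basis alpha n k x * F k)) = c1 * m0 - c2 * m2 + y.
  apply: cvg_lim => //.
  rewrite (_ : _ + y =
      1 * (c1 * m0 + c1 * y * 1) + -1 * (c2 * m2 + c2 * y * 1)); last first.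
    by rewrite /c1 /c2; ring.
  apply: eq_cvg_series h => k; rewrite p_basisE// -/c1 -/c2.
  by case: k => [|[|k]] /=; ring.
rewrite addrK (le_trans (ler_normB _ _))// (normrM c1) (normrM c2).
have c20 : 0 <= c2 by rewrite mulr_ge0//; lra.
have c10 : 0 <= c1 by rewrite addr_ge0// mulr_ge0//; lra.
rewrite (ger0_norm c10) (ger0_norm c20).
apply: (@le_trans _ _ ((c1 + c2) * Q)).
  by rewrite [leRHS]mulrDl lerD// ler_wpM2l.
have Q0 : 0 <= Q by exact: le_trans m0le.
by rewrite ler_wpM2r// /c1 /c2; nra.
Qed.

Lemma A_op_uniform_dist alpha rho A f e :
  0 <= alpha -> alpha <= 1 -> 0 < rho -> 0 < A ->
  C_B f -> 0 < e ->
  \forall n \near \oo, forall x, 0 <= x -> x <= A ->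
    `|A_op alpha rho n f x - f x| < e.
Proof.
move=> al0 al1 rho0 A0 [cf [M0 [_ fb]]] e0.
(* Boundedness provides every number strictly above [M0] as a bound. *)
have fM t : 0 <= t -> `|f t| <= M0 + 1.
  by move=> t0; apply: fb; [lra|rewrite /halfline/= in_itv/= t0].
have mf : measurable_fun halfline f.
  by apply: subspace_continuous_measurable_fun => //; exact: measurable_halfline.
(* The final bound is [(1 + 2A)(e1 + Q/n)]; each summand gets half of [e / (1 + 2A)]. *)
pose e1 := e / (2 * (1 + 2 * A)).
have e10 : 0 < e1 by rewrite divr_gt0// mulr_gt0//; lra.
have [C C0 fC] := korovkin_odds f A _ e1 cf fM A0 e10.
pose D := 2 * ((2 * rho + 1) / rho) ^+ 2 + rho^-1.
have D0 : 0 <= D.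
  by apply: addr_ge0; [apply: mulr_ge0 => //; exact: sqr_ge0|rewrite invr_ge0 ltW].
(* [Q / n] collects the terms of order [1/n]: kernel bias and variance through [D], the Baskakov
   variance through [x (1+x) <= A (1+A)]. *)
pose Q := C * (D + 2 * (A * (1 + A))).
have Q0 : 0 <= Q by apply: mulr_ge0 => //; nra.
near=> n => x x0 xA.
have n1 : (0 < n)%N by near: n; exists 1%N.
have N1 : 1 <= n%:R :> R by rewrite ler1n.
have N0 : 0 < n%:R :> R by lra.
(* The Beta estimates ask for second parameter at least 1, which large [n] secures even for small
   [rho]. *)
have Nrho : 1 <= n%:R * rho.
  rewrite -ler_pdivrMr//; near: n; exact: nbhs_infty_ger.
have QN : Q / n%:R < e1.
  rewrite ltr_pdivrMr// mulrC -ltr_pdivrMr//; near: n; exact: nbhs_infty_gtr.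
pose F k := \int[lebesgue_measure]_(t in halfline) (mu_kernel rho n k t * f t).
(* Applied with [j = 0] and [j = 2], for the two positive operators. *)
have FD j k : (j <= 2)%N -> `|F (k + j)%N - f x| <=
    (e1 + C * (D / n%:R)) + C * (2 / n%:R ^+ 2) * (k%:R - n%:R * x) ^+ 2.
  move=> j2; have J2 : j%:R <= 2 :> R by rewrite (ler_nat R j 2).
  rewrite /F; under eq_Rintegral do rewrite mu_kernelE.
  have K0 : 0 <= (k + j)%:R * rho by rewrite mulr_ge0// ltW.
  apply: (le_trans (beta_prime_mean_dist _ _ (odds x) _ _ e1 C K0 Nrho C0 mf _)).
    by move=> t t0; exact: fC.
  rewrite [leRHS](_ : _ = e1 +
    C * (2 / n%:R ^+ 2 * (k%:R - n%:R * x) ^+ 2 + D / n%:R)); last by ring.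
  by rewrite lerD2l ler_wpM2l// natrD; exact: beta_mean_dist.
apply: (@le_lt_trans _ _ ((1 + 2 * x) *
    ((e1 + C * (D / n%:R)) + C * (2 / n%:R ^+ 2) * (n%:R * x * (1 + x))))).
  apply: (series_p_basis_dist alpha n x F) => // k.
    by have := FD 0%N k isT; rewrite addn0.
  by have := FD 2%N k isT; rewrite addn2.
have -> : (e1 + C * (D / n%:R)) + C * (2 / n%:R ^+ 2) * (n%:R * x * (1 + x)) =
    e1 + C * (D + 2 * (x * (1 + x))) / n%:R by field; lra.
have QQ : C * (D + 2 * (x * (1 + x))) / n%:R <= Q / n%:R.
  rewrite ler_wpM2r ?invr_ge0 ?(ltW N0)// ler_wpM2l// lerD2l.
  by rewrite ler_wpM2l// ler_pM//; lra.
have e1E : (1 + 2 * A) * (2 * e1) = e by rewrite /e1; field; lra.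
apply: (@le_lt_trans _ _ ((1 + 2 * A) * (e1 + C * (D + 2 * (x * (1 + x))) / n%:R))).
  rewrite ler_wpM2r//; last by lra.
  by rewrite addr_ge0 ?(ltW e10)// divr_ge0 ?(ltW N0)//
    mulr_ge0// addr_ge0// !mulr_ge0//; lra.
by rewrite -e1E ltr_pM2l; lra.
Unshelve. all: by end_near. Qed.

End alpha_series.

(** * Uniform convergence on compact subsets of [0, A] *)

Theorem theorem2 (R : realType) (alpha rho A : R)
  (alpha01 : 0 <= alpha <= 1) (rho_gt0 : 0 < rho) (A_gt0 : 0 < A)
  (f : R -> R) (fCD : (C_space `&` D_space) f)
  (K : set R) (K_compact : compact K) (K_sub : K `<=` [set` `[0, A]]) :
  {uniform K, (fun n : nat => A_op alpha rho n f) @ \oo --> f}.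
Proof.
have /andP[al0 al1] := alpha01.
have [_ [fCB _]] := fCD.
(* A neighbourhood of [f] for uniform convergence on [K] contains all functions within some [e] of
   [f] on [K], and the estimate holds at once on all of [[0, A]]. *)
move=> U /uniform_nbhs[E [entE EU]].
move: entE; rewrite -entourage_ballE => -[e /= e0 eE].
have := A_op_uniform_dist alpha rho A f e al0 al1 rho_gt0 A_gt0 fCB e0.
apply: filterS => n An; apply: EU => x Kx; apply: eE => /=.
have := K_sub _ Kx; rewrite /= in_itv/= => /andP[x0 xA].
by rewrite /ball/= distrC; exact: An.
Qed.
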